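(* There is an infinite compact set $E\subseteq\mathbb{R}$ such that $$\{\dim_A\mu:\ \mu\text{ a finite, positive Borel measure on }\mathbb{R}\text{ with }\operatorname{supp}\mu=E\}=\{0,\infty\}.$$
   Context: $B(x,R)$ is the open ball with centre $x$ and radius $R$. The upper Assouad dimension of a finite, positive Borel measure $\mu$ with support $\operatorname{supp}\mu$ is $$\dim_A\mu=\inf\Big\{\alpha:(\exists C_1,C_2>0)(\forall\,0<r\le R\le C_1)\ \sup_{x\in\operatorname{supp}\mu}\frac{\mu(B(x,R))}{\mu(B(x,r))}\le C_2\Big(\frac Rr\Big)^{\alpha}\Big\},$$ with the convention $\inf\emptyset=\infty$. *)

(* Defs.v *)
From HB Require Import structures.
From mathcomp Require Import all_boot all_order all_algebra.
From mathcomp Require Import all_classical all_reals all_analysis.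

Set Implicit Arguments.
Unset Strict Implicit.
Unset Printing Implicit Defensive.

Import Order.TTheory GRing.Theory Num.Theory.
Import numFieldNormedType.Exports.

Local Open Scope classical_set_scope.
Local Open Scope ring_scope.

(* [measurableTypeR R] is the real line with the sigma-algebra generated by the
   bounded half-open intervals, that is, the Borel sigma-algebra. *)
Notation finite_borel_measure R :=
  {finite_measure set (measurableTypeR R) -> \bar R}.

Definition supp (R : realType) (mu : finite_borel_measure R) : set R :=
  [set x : R | forall U : set R, open U -> U x -> (0 < mu U)%E].

(* The quotients below have finite positive numerators and denominators, since
   their centres lie in the support; the supremum is taken in [\bar R]. *)
Definition assouad_exponent (R : realType) (mu : finite_borel_measure R)
    (alpha : R) : Prop :=
  exists C1 C2 : R, [/\ 0 < C1, 0 < C2 &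
    forall r rho : R, 0 < r -> r <= rho -> rho <= C1 ->
      (ereal_sup [set mu (ball x rho) / mu (ball x r) | x in supp mu]
       <= (C2 * (rho / r) `^ alpha)%:E)%E].

(* [ereal_inf set0 = +oo], as in the convention for the empty set. *)
Definition dim_A (R : realType) (mu : finite_borel_measure R) : \bar R :=
  ereal_inf [set alpha%:E | alpha in assouad_exponent mu].

(* Main.v *)
(** Let [E = {0} \cup {1/(n+4)! : n}]. Two distinct points of [E] are at a
    distance between [z/2] and [z], where [z] is the larger one, and consecutive
    points have ratio tending to infinity. Hence a ball of small radius [r] around
    a point of [E] can gain mass only once when its radius grows to [M r], and a
    measure with support [E] and some finite exponent has every positive exponent:
    its dimension is [0] or infinite. The measure with mass [2^-(n+1)] at [1/(n+4)!]
    is doubling and has dimension [0]; adding an atom at [0] makes the mass of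
    [{1/(n+4)!}] negligible against that of nearby balls, so that no exponent is
    left. *)
Require Import Defs.
From HB Require Import structures.
From mathcomp Require Import all_boot all_order all_algebra.
From mathcomp Require Import all_classical all_reals all_analysis.
From mathcomp Require Import ring lra.
Import Order.TTheory GRing.Theory Num.Theory.
Import numFieldNormedType.Exports.
Local Open Scope classical_set_scope.
Local Open Scope ring_scope.

Set Implicit Arguments.
Unset Strict Implicit.
Unset Printing Implicit Defensive.

(** * Null complement of the support *)

(** The complement of the support is null: by second countability it is covered by countably many
    rational intervals of measure zero. *)
Lemma le_measure_supp (R : realType) (mu : finite_borel_measure R)
    (A B : set (measurableTypeR R)) :
  measurable A -> measurable B -> A `&` supp mu `<=` B ->
  (mu A <= mu B)%E.
Proof.
move=> mA mB AB.
pose itv (pq : rat * rat) : set (measurableTypeR R) :=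
  [set` `](ratr pq.1 : R), (ratr pq.2 : R)[].
(* Intervals of positive mass are replaced by [set0], so that the whole union is null. *)
pose F n : set (measurableTypeR R) :=
  if unpickle n is Some pq then if mu (itv pq) == 0%E then itv pq else set0
  else set0.
have mitv pq : measurable (itv pq) by exact: measurable_itv.
have mF n : measurable (F n).
  by rewrite /F; case: unpickle => [pq|]; [case: ifP|].
have F0 n : mu (F n) = 0%E.
  rewrite /F; case: unpickle => [pq|]; last exact: measure0.
  by case: ifP => [/eqP//|_]; exact: measure0.
have UF0 : mu (\bigcup_n F n) = 0%E.
  apply: measure_negligible; first exact: bigcup_measurable.
  by apply: negligible_bigcup => n; exists (F n); split=> //; exact: F0.
have sF x : ~ supp mu x -> (\bigcup_n F n) x.
  move=> /existsNP[U /= /not_implyP[oU]].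
  move=> /not_implyP[Ux] /negP.
  rewrite -leNgt => muU.
  have [e /= e0 eU] : exists2 e : R, 0 < e & ball x e `<=` U.
    by have /nbhs_ballP[e e0 eU] := open_nbhs_nbhs (conj oU Ux); exists e.
  have xl : x - e < x by rewrite ltrBlDr ltrDl.
  have xr : x < x + e by rewrite ltrDl.
  have [p] := rat_in_itvoo xl; rewrite in_itv/= => /andP[p1 p2].
  have [q] := rat_in_itvoo xr; rewrite in_itv/= => /andP[q1 q2].
  exists (pickle (p, q)); first exact: I.
  rewrite /F pickleK.
  have itvU : itv (p, q) `<=` U.
    move=> y; rewrite /itv set_itvoo => /andP[y1 y2]; apply: eU.
    by rewrite -ball_normE/= ltr_norml; apply/andP; split; lra.
  suff /eqP -> : mu (itv (p, q)) == 0%E by rewrite eqxx /itv set_itvoo /= p2.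
  rewrite -measure_le0 (le_trans _ muU)//; apply: le_measure; rewrite ?inE//.
  exact: measurable_realfun.open_measurable.
rewrite -(measureU0 mB _ UF0); last exact: bigcup_measurable.
apply: le_measure; rewrite ?inE//.
  by apply: measurableU => //; exact: bigcup_measurable.
move=> x Ax; have [sx|/sF] := pselect (supp mu x); last by right.
by left; apply: AB.
Qed.

(** * Ball masses and Assouad exponents in real arithmetic *)

Definition ball_mass (R : realType) (mu : finite_borel_measure R) (x r : R) :=
  fine (mu (ball x r)).

Lemma ball_massE (R : realType) (mu : finite_borel_measure R) (x r : R) :
  mu (ball x r) = (ball_mass mu x r)%:E.
Proof.
rewrite fineK//; apply: fin_num_measure.
exact: measurable_realfun.measurable_ball.
Qed.

Lemma ball_mass_ge0 (R : realType) (mu : finite_borel_measure R) (x r : R) :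
  0 <= ball_mass mu x r.
Proof. exact: fine_ge0. Qed.

Lemma ball_mass_gt0 (R : realType) (mu : finite_borel_measure R) (x r : R) :
  supp mu x -> 0 < r -> 0 < ball_mass mu x r.
Proof.
move=> sx r0; rewrite -lte_fin -ball_massE; apply: sx.
  exact: ball_open.
exact: ballxx.
Qed.

(** Since only points of the support carry mass, balls can be compared by inspecting points of the
    support alone. *)
Lemma le_ball_mass (R : realType) (mu : finite_borel_measure R)
    (x r y s : R) :
  (forall z, supp mu z -> `|x - z| < r -> `|y - z| < s) ->
  ball_mass mu x r <= ball_mass mu y s.
Proof.
move=> rs; rewrite -lee_fin -!ball_massE; apply: le_measure_supp.
- exact: measurable_realfun.measurable_ball.
- exact: measurable_realfun.measurable_ball.
- by move=> z []; rewrite -!ball_normE/= => xz sz; exact: rs.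
Qed.

Lemma assouad_exponentP (R : realType) (mu : finite_borel_measure R)
    (alpha : R) :
  assouad_exponent mu alpha <->
  exists C1 C2 : R, [/\ 0 < C1, 0 < C2 &
    forall x r rho : R, supp mu x -> 0 < r -> r <= rho -> rho <= C1 ->
      ball_mass mu x rho <= C2 * (rho / r) `^ alpha * ball_mass mu x r].
Proof.
have E x r rho : supp mu x -> 0 < r ->
    (mu (ball x rho) / mu (ball x r))%E
    = (ball_mass mu x rho / ball_mass mu x r)%:E.
  by move=> sx r0; rewrite !ball_massE inver gt_eqF ?ball_mass_gt0.
split=> -[C1 [C2 [C10 C20 H]]]; exists C1, C2; split=> //.
  move=> x r rho sx r0 rrho rhoC; rewrite -ler_pdivrMr ?ball_mass_gt0//.
  rewrite -lee_fin -E//; apply: le_trans (H _ _ r0 rrho rhoC).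
  by apply: ereal_sup_ubound; exists x.
move=> r rho r0 rrho rhoC; apply: ge_ereal_sup => _ [x sx <-].
by rewrite E// lee_fin ler_pdivrMr ?ball_mass_gt0// H.
Qed.

Lemma assouad_exponent_ge0 (R : realType) (mu : finite_borel_measure R)
    (x alpha : R) :
  supp mu x -> assouad_exponent mu alpha -> 0 <= alpha.
Proof.
move=> sx /assouad_exponentP[C1 [C2 [C10 C20 H]]].
rewrite leNgt; apply/negP => a0.
(* For negative [alpha] this ratio of radii makes the bound [C2 / (C2 + 1) < 1], although mass
   increases with the radius. *)
pose K := (C2 + 1) `^ (- alpha)^-1.
have Ka : K `^ alpha = (C2 + 1)^-1.
  rewrite -powRrM invrN mulNr mulVf ?lt_eqF// powR_inv1//; lra.
have K1 : 1 <= K.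
  rewrite -[leLHS](powRr0 (C2 + 1)); apply: ler_powR; first lra.
  by rewrite invr_ge0 oppr_ge0 ltW.
have K0 : 0 < K by apply: lt_le_trans K1.
have r0 : 0 < C1 / K by rewrite divr_gt0.
have rC : C1 / K <= C1 by rewrite ler_pdivrMr// ler_peMr// ltW.
have := H x _ C1 sx r0 rC (lexx _).
rewrite invf_div mulrCA divff ?gt_eqF// mulr1 Ka.
have m0 := ball_mass_gt0 sx r0.
have : ball_mass mu x (C1 / K) <= ball_mass mu x C1.
  by apply: le_ball_mass => z _ /lt_le_trans; apply.
move=> h1 h2; have : ball_mass mu x (C1 / K)
    <= C2 * (C2 + 1)^-1 * ball_mass mu x (C1 / K) by exact: le_trans h2.
rewrite -ler_pdivrMr// divff ?gt_eqF// ler_pdivlMr; lra.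
Qed.

(* Iterating the bound over the scales [r, M r, M^2 r, ...] costs a factor
   [M `^ e] per step, which is what the exponent [e] allows. *)
Lemma assouad_exponent_of_step (R : realType) (mu : finite_borel_measure R)
    (e M r0 : R) :
  0 <= e -> 2 <= M -> 0 < r0 ->
  (forall x r : R, supp mu x -> 0 < r -> r <= r0 ->
    ball_mass mu x (M * r) <= M `^ e * ball_mass mu x r) ->
  assouad_exponent mu e.
Proof.
move=> e0 M2 r00 step; apply/assouad_exponentP.
have M0 : 0 < M by lra.
have M1 : 1 <= M by lra.
(* The constant pays for the last step, which may overshoot [rho]. *)
exists r0, (M `^ e); split=> //; first exact: powR_gt0.
move=> x r rho sx rgt0 rrho rhor0.
have [n hn] : exists n, rho <= M ^+ n * r.
  have [n hn] : exists n, rho / r <= M ^+ n.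
    (* Any [t] is below 2 to the power [Num.bound t], and [2 <= M]. *)
    exists (Num.bound (rho / r)).
    have /ltW/le_trans := upper_nthrootP (leqnn (Num.bound (rho / r))); apply.
    by rewrite lerXn2r// nnegrE; lra.
  by exists n; rewrite -ler_pdivrMr.
elim: n r rgt0 rrho hn => [|n IH] r rgt0 rrho hn.
  have -> : rho = r by apply/eqP; rewrite eq_le rrho andbT -[r]mul1r.
  rewrite divff ?gt_eqF// powR1 mulr1 ler_peMl ?ball_mass_ge0//.
  by rewrite -(powRr0 M) ler_powR.
have [rhoM|Mrho] := leP rho (M * r).
  apply: (@le_trans _ _ (ball_mass mu x (M * r))).
    by apply: le_ball_mass => z _ /lt_le_trans; apply.
  apply: le_trans (step _ _ sx rgt0 (le_trans rrho rhor0)) _.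
  rewrite -mulrA ler_pM2l ?powR_gt0// ler_peMl ?ball_mass_ge0//.
  by rewrite -(powRr0 (rho / r)) ler_powR// ler_pdivlMr ?mul1r.
have Mr0 : 0 < M * r by rewrite mulr_gt0.
have := IH _ Mr0 (ltW Mrho); rewrite mulrA -exprSr => /(_ hn) h.
apply: le_trans h _.
have rho0 : 0 < rho := lt_le_trans rgt0 rrho.
have -> : rho / r = rho / (M * r) * M by field; rewrite !gt_eqF.
rewrite (@powRM _ _ M) ?(ltW M0) ?(ltW (divr_gt0 _ _))// -!mulrA.
do 2! rewrite ler_pM2l ?powR_gt0 ?divr_gt0//.
exact: step sx rgt0 (le_trans rrho rhor0).
Qed.

(** * The points 1/(n+4)! and their gaps *)

(** Starting at [4!] makes the ratio of consecutive points [n + 5], hence at least 5 everywhere. *)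
Definition pt (R : realType) (n : nat) : R := (n.+4`!%:R)^-1.

Definition pt_set (R : realType) : set R := 0 |` range (pt R).
Arguments pt_set : clear implicits.

Lemma pt_gt0 (R : realType) (n : nat) : 0 < pt R n.
Proof. by rewrite invr_gt0 ltr0n fact_gt0. Qed.

Lemma ptS (R : realType) (n : nat) : n.+1.+4%:R * pt R n.+1 = pt R n.
Proof. by rewrite /pt factS natrM invfM mulrA divff ?mul1r// pnatr_eq0. Qed.

Lemma le_pt (R : realType) (m n : nat) : (m <= n)%N -> pt R n <= pt R m.
Proof.
elim: n => [|n IH]; first by rewrite leqn0 => /eqP ->.
rewrite leq_eqVlt => /predU1P[->//|/IH]; apply: le_trans.
by rewrite -(ptS R n) ler_peMl ?(ltW (pt_gt0 _ _))// ler1n.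
Qed.

Lemma pt_gap (R : realType) (m n : nat) :
  (m < n)%N -> n.+4%:R * pt R n <= pt R m.
Proof. by case: n => // n mn; rewrite ptS le_pt. Qed.

Lemma lt_pt (R : realType) (m n : nat) : (pt R n < pt R m) = (m < n)%N.
Proof.
apply/idP/idP; first by rewrite ltnNge; apply: contraTN => /(le_pt R); rewrite -leNgt.
move=> /(pt_gap R); apply: lt_le_trans.
by rewrite ltr_pMl ?pt_gt0// ltr1n.
Qed.

Lemma pt_cvg0 (R : realType) (e : R) : 0 < e -> exists n, pt R n < e.
Proof.
move=> e0; exists (Num.bound e^-1).
rewrite -[ltRHS]invrK ltf_pV2 ?posrE ?invr_gt0// ?ltr0n ?fact_gt0//.
have := @archi_boundP R e^-1; rewrite invr_ge0 => /(_ (ltW e0)).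
move=> /lt_le_trans; apply; rewrite ler_nat.
apply: leq_trans _ (fact_geq _).
by do 4 apply: leqW.
Qed.

Lemma pt_set_ge0 (R : realType) (x : R) : pt_set R x -> 0 <= x.
Proof. by move=> [->//|[n _ <-]]; exact/ltW/pt_gt0. Qed.

Lemma pt_set_gap (R : realType) (x y : R) :
  pt_set R x -> pt_set R y -> x < y -> 5 * x <= y.
Proof.
move=> + [->|[m _ <-]]; first by move=> /pt_set_ge0; lra.
move=> [-> _|[n _ <-]]; first by rewrite mulr0 ltW ?pt_gt0.
rewrite lt_pt => mn; apply: le_trans (pt_gap R mn).
by rewrite ler_pM2r ?pt_gt0// ler_nat; case: n mn.
Qed.

(** A positive point below [pt R (Num.bound K)] has an index [n > Num.bound K], and every larger
    point exceeds it by a factor at least [n + 4]. *)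
Lemma pt_set_big_gap (R : realType) (K : R) : 0 < K -> exists2 eta : R, 0 < eta &
  forall x y, pt_set R x -> pt_set R y -> 0 < x -> x < eta -> x < y -> K * x < y.
Proof.
move=> K0; exists (pt R (Num.bound K)); first exact: pt_gt0.
move=> x y [->|[n _ <-]]; first by rewrite ltxx.
move=> [->|[m _ <-]] _; first by move=> _; rewrite ltNge ltW ?pt_gt0.
rewrite !lt_pt => Kn mn; apply: lt_le_trans (pt_gap R mn).
rewrite ltr_pM2r ?pt_gt0//; apply: lt_le_trans (archi_boundP (ltW K0)) _.
by rewrite ler_nat; do 4 apply: leqW; exact: ltnW.
Qed.

(** The smaller point is at most a fifth of the larger one, so subtracting it removes less than
    half. *)
Lemma pt_set_dist (R : realType) (x y : R) :
  pt_set R x -> pt_set R y -> x != y ->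
  [/\ 0 < Num.max x y, Num.max x y / 2 <= `|x - y| & `|x - y| <= Num.max x y].
Proof.
move=> Ex Ey; have x0 := pt_set_ge0 Ex; have y0 := pt_set_ge0 Ey.
rewrite neq_lt => /orP[xy|yx].
  have := pt_set_gap Ex Ey xy; rewrite ltr0_norm ?subr_lt0// (max_r (ltW xy)).
  by split; lra.
have := pt_set_gap Ey Ex yx; rewrite gtr0_norm ?subr_gt0// (max_l (ltW yx)).
by split; lra.
Qed.

(** * From one finite exponent to all positive exponents *)

(* At small scales, an annulus of ratio [M] around a point of the set meets it
   in a single dyadic annulus, so that passing from radius [r] to [M r] costs no
   more than one application of the bound with ratio 4, however large [M] is. *)
Lemma assouad_exponent_pos (R : realType) (mu : finite_borel_measure R)
    (alpha e : R) :
  supp mu = pt_set R -> assouad_exponent mu alpha -> 0 < e ->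
  assouad_exponent mu e.
Proof.
move=> sE /assouad_exponentP[C1 [C2 [C10 C20 H]]] e0.
pose D := C2 * 4 `^ alpha.
have D0 : 0 < D by rewrite mulr_gt0// powR_gt0.
(* [D] is the cost of one application of the bound with ratio 4; [M] is large enough for its power
   [e] to absorb it. *)
pose M := Num.max 2 (D `^ e^-1).
have M2 : 2 <= M by rewrite le_max lexx.
have DM : D <= M `^ e.
  rewrite -[leLHS]powRr1 ?(ltW D0)// -(@mulVf _ e) ?gt_eqF// powRrM.
  apply: ge0_ler_powR; rewrite ?nnegrE ?powR_ge0 ?(ltW e0)//; first lra.
  by rewrite le_max lexx orbT.
have M1 : 1 <= M `^ e by rewrite -(powRr0 M) ler_powR ?ltW//; lra.
have M20 : 0 < 2 * M by lra.
have [eta eta0 gap] := pt_set_big_gap M20.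
(* This keeps [4 * (M * r)] below [C1], where the bound applies, and below [eta], where the gaps
   exceed [2 * M]. *)
pose r0 := Num.min C1 eta / (4 * M).
have m0 : 0 < Num.min C1 eta by rewrite lt_min C10.
have r00 : 0 < r0 by rewrite divr_gt0//; lra.
apply: (@assouad_exponent_of_step _ _ _ M r0); rewrite ?(ltW e0)//.
move=> x r sx rgt0 rr0.
have : 4 * (M * r) <= Num.min C1 eta.
  by rewrite mulrA mulrC -ler_pdivlMr//; lra.
rewrite le_min => /andP[rC reta].
have [[y [sy ry yr]]|/forallNP noy] :=
    pselect (exists y, [/\ supp mu y, r <= `|x - y| & `|x - y| < M * r]); last first.
  apply: (@le_trans _ _ (ball_mass mu x r)); last first.
    by rewrite ler_peMl ?ball_mass_ge0.
  apply: le_ball_mass => z sz xz; rewrite ltNge; apply/negP => rz.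
  by apply: (noy z).
have Mr : r < M * r by apply: le_lt_trans yr.
have dist z : supp mu z -> r <= `|x - z| ->
    [/\ 0 < Num.max x z, Num.max x z / 2 <= `|x - z| & `|x - z| <= Num.max x z].
  move=> sz rz; apply: pt_set_dist; rewrite -?sE//.
  by apply: contraTneq rz => ->; rewrite subrr normr0 -ltNge.
have maxE z : supp mu z -> pt_set R (Num.max x z).
  by move=> sz; rewrite -sE; case: leP.
pose z := Num.max x y.
have [z0 zl zr] := dist _ sy ry.
(* Two maxima [t < u] arising from the annulus would satisfy [u / 2 < M * r <= M * t], against the
   gap factor [2 * M]. *)
have oneE y' : supp mu y' -> r <= `|x - y'| -> `|x - y'| < M * r ->
    Num.max x y' = z.
  move=> sy' ry' yr'; have [z'0 zl' zr'] := dist _ sy' ry'.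
  have MK t u : t / 2 < M * r -> r <= u -> t < 2 * M * u.
    move=> h1 h2; have : M * r <= M * u by rewrite ler_pM2l//; lra.
    lra.
  apply/eqP; rewrite eq_le !leNgt; apply/andP; split; apply/negP => lt'.
    have := gap _ _ (maxE _ sy) (maxE _ sy') z0; rewrite -/z => /(_ _ lt').
    have zeta : z < eta by rewrite /z in zl *; lra.
    by move=> /(_ zeta); rewrite ltNge => /negP; apply; apply/ltW/MK; rewrite /z; lra.
  have := gap _ _ (maxE _ sy') (maxE _ sy) z'0; rewrite -/z => /(_ _ lt').
  have zeta : Num.max x y' < eta by lra.
  by move=> /(_ zeta); rewrite ltNge => /negP; apply; apply/ltW/MK; rewrite /z in zl *; lra.
(* Points of the annulus lie at distance between [z / 2] and [z] from [x]: radius [s] gains nothing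
   over [r], and radius [4 * s] already captures all of them. *)
pose s := Num.max r (z / 2).
have rs : r <= s by rewrite le_max lexx.
have zs : z / 2 <= s by rewrite le_max lexx orbT.
have s0 : 0 < s by apply: lt_le_trans rs.
have sM : s < M * r by rewrite gt_max Mr (le_lt_trans zl yr).
have big : ball_mass mu x (M * r) <= ball_mass mu x (4 * s).
  apply: le_ball_mass => y' sy' xy'.
  have [|ry'] := ltP `|x - y'| r; first lra.
  have [_ _] := dist _ sy' ry'; rewrite (oneE _ sy' ry' xy'); lra.
have small : ball_mass mu x s <= ball_mass mu x r.
  apply: le_ball_mass => y' sy' xy'; rewrite ltNge; apply/negP => ry'.
  have [_ + _] := dist _ sy' ry'; rewrite (oneE _ sy' ry' (lt_trans xy' sM)).
  move: xy'; rewrite lt_max => /orP[|]; lra.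
have sC : 4 * s <= C1 by lra.
have s4 : s <= 4 * s by lra.
have := H x s (4 * s) sx s0 s4 sC.
rewrite mulfK ?gt_eqF// -/D => h.
apply: (le_trans big); apply: (le_trans h).
by apply: ler_pM => //; rewrite ?ball_mass_ge0// ltW.
Qed.

Lemma dim_A_pt_set (R : realType) (mu : finite_borel_measure R) (alpha : R) :
  supp mu = pt_set R -> assouad_exponent mu alpha -> dim_A mu = 0%E.
Proof.
move=> sE H; have s0 : supp mu 0 by rewrite sE; left.
apply/eqP; rewrite eq_le; apply/andP; split.
  apply/lee_addgt0Pr => e e0; rewrite add0e.
  by apply: ereal_inf_lbound; exists e => //; exact: assouad_exponent_pos H e0.
apply: le_ereal_inf_tmp => _ [b Hb <-].
by rewrite lee_fin; exact: assouad_exponent_ge0 s0 Hb.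
Qed.

(** * Topology of the set *)

(** As the points tend to 0, all but finitely many lie in each segment from 0 to [pt R n];
    intersecting over [n] leaves only 0 as a new point. *)
Lemma closed_pt_set (R : realType) : closed (pt_set R).
Proof.
have -> : pt_set R
    = \bigcap_n ([set pt R k | k in `I_n] `|` `[0, pt R n]).
  apply/seteqP; split=> [x [->|[k _ <-]] n _|x H].
  - by right; rewrite /= in_itv/= lexx ltW// pt_gt0.
  - have [kn|nk] := ltnP k n; first by left; exists k.
    by right; rewrite /= in_itv/= le_pt// ltW// pt_gt0.
  - apply: contrapT => nx; have xle n : 0 <= x <= pt R n.
      by case: (H n I) => [[k _ kx]|//]; case: nx; right; exists k.
    have [x0|x0] := leP x 0.
      by apply: nx; left; apply/eqP; rewrite eq_le x0; case/andP: (xle 0%N).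
    have [n nx'] := pt_cvg0 x0.
    by have /andP[_] := xle n; rewrite leNgt nx'.
apply: closed_bigI => n _; apply: closedU; last exact: itv_closed.
apply: (accessible_finite_set_closed.1 (hausdorff_accessible _)).
  exact: Rhausdorff.
exact/finite_image/finite_II.
Qed.

Lemma compact_pt_set (R : realType) : compact (pt_set R).
Proof.
apply: (@subclosed_compact _ _ `[0, pt R 0]).
- exact: closed_pt_set.
- exact: segment_compact.
- move=> x [->|[k _ <-]]; rewrite /= in_itv/=; last by rewrite le_pt// ltW ?pt_gt0.
  by rewrite lexx ltW ?pt_gt0.
Qed.

Lemma infinite_pt_set (R : realType) : infinite_set (pt_set R).
Proof.
have inj : {in [set: nat] &, injective (pt R)}.
  move=> m n _ _ mn; have := lt_pt R m n; have := lt_pt R n m.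
  by rewrite mn ltxx; case: ltngtP.
move=> /(sub_finite_set (@subsetUr _ [set 0] (range (pt R)))).
by rewrite (eq_finite_set (inj_card_eq inj)); exact: infinite_nat.
Qed.

(** * Two measures carried by the set *)

Definition pt_weight (R : realType) (n : nat) : {nonneg R} :=
  ((2 ^ n.+1)%:R^-1)%:nng.

(** The boolean switches on a unit atom at 0: [false] gives the measure of dimension 0, [true] the
    one of infinite dimension. *)
Definition pt_measure (R : realType) (b : bool) :
    set (measurableTypeR R) -> \bar R :=
  measure_add (mscale b%:R%:nng (dirac (0 : measurableTypeR R)))
    (mseries (fun n => mscale (pt_weight R n)
       (dirac (pt R n : measurableTypeR R))) 0).

Arguments pt_measure : clear implicits.

HB.instance Definition _ (R : realType) (b : bool) :=
  Measure.on (pt_measure R b).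

Lemma pt_measureE (R : realType) (b : bool) (A : set (measurableTypeR R)) :
  pt_measure R b A = (b%:R%:E * (\1_A (0 : R))%:E
    + \sum_(0 <= n <oo) (pt_weight R n)%:num%:E * (\1_A (pt R n))%:E)%E.
Proof. by rewrite /pt_measure measure_addE. Qed.

Lemma pt_weight_series (R : realType) (n : nat) :
  (\sum_(n <= k <oo) (pt_weight R k)%:num%:E <= ((2 ^ n)%:R^-1)%:E)%E.
Proof.
rewrite -(nneseries_addn n (f := fun k => (pt_weight R k)%:num%:E))//.
apply: le_trans (@epsilon_trick0 R ((2 ^ n)%:R^-1) xpredT _) => //.
rewrite le_eqVlt; apply/orP; left; apply/eqP; apply: eq_eseriesr => k _ /=.
by rewrite -addSn expnD natrM invfM mulrC.
Qed.

(** The terms of index below [n] vanish, and the others are bounded by the geometric tail of the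
    weights. *)
Lemma pt_measure_le (R : realType) (b : bool) (n : nat)
    (A : set (measurableTypeR R)) :
  (forall k, A (pt R k) -> (n <= k)%N) ->
  (pt_measure R b A <= (b%:R * \1_A (0 : R) + (2 ^ n)%:R^-1)%:E)%E.
Proof.
move=> An; rewrite pt_measureE EFinD EFinM leeD2l//.
rewrite (nneseries_split 0 n)//.
rewrite big1_seq ?add0e; last first.
  move=> k /=; rewrite mem_index_iota add0n => kn.
  rewrite indicE memNset ?mule0// => /An nk.
  by move: kn; rewrite /= ltnNge nk.
apply: le_trans (pt_weight_series R n); apply: lee_nneseries => k _.
  by rewrite mule_ge0 ?lee_fin.
by rewrite -EFinM lee_fin ler_piMr// indicE; case: (_ \in _).
Qed.

Lemma pt_measure_ge (R : realType) (b : bool) (n : nat)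
    (A : set (measurableTypeR R)) :
  A (pt R n) -> (((2 ^ n.+1)%:R^-1)%:E <= pt_measure R b A)%E.
Proof.
move=> An; rewrite pt_measureE; apply: le_trans (leeDr _ _); last first.
  by rewrite mule_ge0 ?lee_fin.
apply: le_trans (nneseries_lim_ge n.+1 _); last first.
  by move=> k _ _; rewrite mule_ge0 ?lee_fin.
rewrite big_nat_recr//= [in leRHS]indicE mem_set// mule1 leeDr// sume_ge0//.
Qed.

Lemma pt_measure_ge_at0 (R : realType) (b : bool)
    (A : set (measurableTypeR R)) :
  A 0 -> (b%:R%:E <= pt_measure R b A)%E.
Proof.
move=> A0; rewrite pt_measureE [in leRHS]indicE mem_set// mule1 leeDl//.
by apply: nneseries_ge0 => k _ _; rewrite mule_ge0 ?lee_fin.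
Qed.

Lemma pt_measure_eq0 (R : realType) (b : bool)
    (A : set (measurableTypeR R)) :
  (forall x, A x -> ~ pt_set R x) -> pt_measure R b A = 0%E.
Proof.
move=> AE; rewrite pt_measureE indicE memNset; last by move=> /AE; apply; left.
rewrite mule0 add0e eseries0// => k _ _.
by rewrite indicE memNset ?mule0// => /AE; apply; right; exists k.
Qed.

Lemma pt_measure_fin (R : realType) (b : bool) :
  fin_num_fun (pt_measure R b).
Proof.
apply: lty_fin_num_fun; apply: le_lt_trans (ltry _).
exact: (@pt_measure_le R b 0).
Qed.

HB.instance Definition _ (R : realType) (b : bool) :=
  Measure_isFinite.Build _ _ _ (pt_measure R b) (@pt_measure_fin R b).

Lemma supp_pt_measure (R : realType) (b : bool) :
  supp (pt_measure R b) = pt_set R.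
Proof.
have wt0 n : (0 < ((2 ^ n.+1)%:R^-1)%:E :> \bar R)%E.
  by rewrite lte_fin invr_gt0 ltr0n expn_gt0.
apply/seteqP; split=> [x sx|x [->|[n _ <-]] U oU Ux].
- apply: contrapT => nx; have := sx (~` pt_set R) _ nx.
  rewrite [X in (0 < X)%E](_ : _ = 0%E); last exact: pt_measure_eq0.
  by rewrite ltxx => h; have := h (closed_openC (@closed_pt_set R)).
(* Even without an atom, 0 is in the support as the limit of the points [pt R n]. *)
- have /nbhs_ballP[e /= e0 eU] := open_nbhs_nbhs (conj oU Ux).
  have [n ne] := pt_cvg0 e0.
  apply: lt_le_trans (wt0 n) (pt_measure_ge _ _); apply: eU.
  by rewrite -ball_normE/= sub0r normrN gtr0_norm ?pt_gt0.
- exact: lt_le_trans (wt0 n) (pt_measure_ge _ Ux).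
Qed.

(** The condition on [b] keeps 0 out of the ball whenever it carries an atom. *)
Lemma ball_mass_pt_measure_le (R : realType) (b : bool) (x r : R) n :
  (forall k, `|x - pt R k| < r -> (n <= k)%N) -> b ==> (r <= `|x|) ->
  ball_mass (pt_measure R b) x r <= (2 ^ n)%:R^-1.
Proof.
move=> H br; rewrite -lee_fin -ball_massE.
apply: le_trans (@pt_measure_le _ _ n _ _) _.
  by move=> k; rewrite -ball_normE/=; exact: H.
rewrite lee_fin gerDr; case: b br => /= [rx|_]; last by rewrite mul0r.
rewrite indicE memNset ?mulr0//.
by rewrite -ball_normE/= subr0 ltNge rx.
Qed.

Lemma ball_mass_pt_measure_ge (R : realType) (b : bool) (x r : R) n :
  `|x - pt R n| < r -> (2 ^ n.+1)%:R^-1 <= ball_mass (pt_measure R b) x r.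
Proof.
move=> H; rewrite -lee_fin -ball_massE; apply: pt_measure_ge.
by rewrite -ball_normE.
Qed.

(** * Exponents of the two measures *)

(** If [n] is the least index met by the ball of radius [2 * r], its mass is at most 2^-n, while the
    ball of radius [r] contains the point of index [n] or [n + 1] and has mass at least 2^-(n+2).
    The quotient 4 is 2 to the exponent 2. *)
Lemma assouad_exponent_pt_measure (R : realType) :
  assouad_exponent (pt_measure R false) 2.
Proof.
apply: (@assouad_exponent_of_step _ _ _ 2 1) => // x r.
rewrite supp_pt_measure => Ex r0 _.
have r20 : 0 < 2 * r by lra.
have [n0 n0P] : exists n, `|x - pt R n| < 2 * r.
  case: Ex => [->|[n _ <-]]; last by exists n; rewrite subrr normr0.
  have [n nr] := pt_cvg0 r20; exists n.
  by rewrite sub0r normrN gtr0_norm ?pt_gt0.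
case: (@ex_minnP (fun n => `|x - pt R n| < 2 * r)); first by exists n0.
move=> n nP nmin {n0 n0P}.
have := @ball_mass_pt_measure_le R false x (2 * r) n nmin isT.
move=> /le_trans; apply.
rewrite -[X in _ `^ X]/(2%:R) powR_mulrn//.
have w m : (2 ^ m.+1)%:R^-1 = (2 ^ m)%:R^-1 / 2 :> R.
  by rewrite expnS natrM invfM mulrC.
have w0 : 0 <= (2 ^ n)%:R^-1 :> R by [].
have [xn|xn] := eqVneq x (pt R n).
  have : `|x - pt R n| < r by rewrite xn subrr normr0.
  move=> /(@ball_mass_pt_measure_ge R false); rewrite w; lra.
have xlt : x < pt R n.
  case: Ex xn nmin => [->|[m _ <-]]; first by rewrite pt_gt0.
  rewrite lt_neqAle => -> /(_ m); rewrite subrr normr0 => /(_ r20).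
  exact: le_pt.
have En : pt_set R (pt R n) by right; exists n.
have x0 := pt_set_ge0 Ex.
have x5 := pt_set_gap Ex En xlt.
have En1 : pt_set R (pt R n.+1) by right; exists n.+1.
have n5 := pt_set_gap En1 En; rewrite lt_pt ltnSn in n5.
have {}n5 := n5 isT.
have n1 := pt_gt0 R n.+1.
(* Both [x] and [pt R n.+1] are at most [pt R n / 5], and [pt R n - x < 2 * r] gives
   [pt R n < 5 * r / 2]. *)
have : `|x - pt R n.+1| < r.
  move: nP; rewrite ltr0_norm ?subr_lt0// => nP.
  by rewrite ltr_norml; apply/andP; split; lra.
move=> /(@ball_mass_pt_measure_ge R false); rewrite !w; lra.
Qed.

(** Around [pt R n], the ball of radius [2 * pt R n] contains the unit atom, while that of radius
    [pt R n / 2] has mass at most 2^-n. The ratio of radii stays 4, so the constant [D] would have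
    to be at least 2^n. *)
Lemma no_assouad_exponent_pt_measure (R : realType) (alpha : R) :
  ~ assouad_exponent (pt_measure R true) alpha.
Proof.
move=> /assouad_exponentP[C1 [C2 [C10 C20 H]]].
pose D := C2 * 4 `^ alpha.
have C0 : 0 < C1 / 2 by lra.
have [N NC] := pt_cvg0 C0.
(* [N] brings the larger radius below [C1], and [Num.bound D] makes 2^n exceed [D]. *)
pose n := maxn N (Num.bound D).
have nC : pt R n <= C1 / 2 by rewrite (le_trans _ (ltW NC))// le_pt// leq_maxl.
have n0 := pt_gt0 R n.
have sn : supp (pt_measure R true) (pt R n).
  by rewrite supp_pt_measure; right; exists n.
have := H (pt R n) (pt R n / 2) (2 * pt R n) sn.
have -> : 2 * pt R n / (pt R n / 2) = 4 by field; rewrite gt_eqF.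
rewrite -/D => /(_ _ _ _)/[!divr_gt0]// h.
have {h} h : ball_mass (pt_measure R true) (pt R n) (2 * pt R n)
    <= D * ball_mass (pt_measure R true) (pt R n) (pt R n / 2).
  by apply: h; lra.
have le1 : 1 <= ball_mass (pt_measure R true) (pt R n) (2 * pt R n).
  rewrite -lee_fin -ball_massE; apply: pt_measure_ge_at0.
  by rewrite -ball_normE/= subr0 gtr0_norm//; lra.
have lew : ball_mass (pt_measure R true) (pt R n) (pt R n / 2) <= (2 ^ n)%:R^-1.
  apply: ball_mass_pt_measure_le; last first.
    by rewrite /= gtr0_norm// ler_pdivrMr// ler_peMr ?ler1n// ltW.
  move=> k; rewrite leqNgt => nk; apply/negP => kn; move: nk.
  have En : pt_set R (pt R n) by right; exists n.
  have Ek : pt_set R (pt R k) by right; exists k.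
  have := pt_set_gap En Ek; rewrite lt_pt => /(_ kn) h5.
  by rewrite ltr0_norm; move: h5 n0; clear; lra.
have D0 : 0 < D by rewrite mulr_gt0// powR_gt0.
have Dn : D < (2 ^ n)%:R by rewrite natrX; apply: upper_nthrootP; rewrite leq_maxr.
have := le_trans le1 (le_trans h (ler_wpM2l (ltW D0) lew)).
by rewrite ler_pdivlMr ?mul1r ?leNgt ?Dn// (lt_trans D0).
Qed.

Theorem proposition3p8 (R : realType) :
  exists E : set R,
    [/\ infinite_set E, compact E &
      [set dim_A mu | mu in [set mu : finite_borel_measure R | supp mu = E]]
      = [set 0%E; +oo%E]].
Proof.
exists (pt_set R); split; [exact: infinite_pt_set|exact: compact_pt_set|].
apply/seteqP; split=> [d [mu sE <-{d}]|_ [->|->]].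
- have [[alpha H]|/forallNP H] := pselect (exists alpha, assouad_exponent mu alpha).
    by left; exact: dim_A_pt_set H.
  right; rewrite /= /dim_A [X in ereal_inf X](_ : _ = set0) ?ereal_inf0//.
  by apply/seteqP; split=> // d [alpha /H].
- exists (pt_measure R false); first exact: supp_pt_measure.
  by apply: dim_A_pt_set (assouad_exponent_pt_measure R); exact: supp_pt_measure.
- exists (pt_measure R true); first exact: supp_pt_measure.
  rewrite /dim_A [X in ereal_inf X](_ : _ = set0) ?ereal_inf0//.
  by apply/seteqP; split=> // d [alpha /no_assouad_exponent_pt_measure].
Qed.
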